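(* Let the standing assumptions (i)–(iv) of the context on $A,Q,L,\mathcal C,f$ hold, let the exact data $b$ be consistent, and let $x^\dagger$ be the unique solution of $$\min\{f(Lx): Ax=b,\ x\in\mathcal C,\ x\in\mathrm{dom}(L)\}.$$ Let $\{z^k,y^k,x^k,\lambda^k,\mu^k,\nu^k\}$ be defined by the proximal ADMM of the context with noisy data $b^\delta$ satisfying $\|b^\delta-b\|\le\delta$. Assume $x^\dagger$ satisfies the source condition: there exist $\mu^\dagger\in\partial f(Lx^\dagger)\cap\mathrm{dom}(L^* )$ and $\nu^\dagger\in\partial\iota_{\mathcal C}(x^\dagger)$ such that $L^*\mu^\dagger+\nu^\dagger\in\mathrm{Ran}(A^* )$. Then for the integer $k_\delta$ chosen by $k_\delta\sim\delta^{-1}$ there hold $$\|x^{k_\delta}-x^\dagger\|=O(\delta^{1/4}),\quad \|y^{k_\delta}-Lx^\dagger\|=O(\delta^{1/4})\quad\text{and}\quad \|z^{k_\delta}-x^\dagger\|=O(\delta^{1/4})$$ as $\delta\to0$.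
   Context: $\mathcal X,\mathcal Y,\mathcal H$ are real Hilbert spaces. Standing assumptions: (i) $A:\mathcal X\to\mathcal H$ is a bounded linear operator, $Q:\mathcal X\to\mathcal X$ is a bounded linear positive semi-definite self-adjoint operator, and $\mathcal C\subset\mathcal X$ is a closed convex subset. (ii) $L$ is a densely defined, closed, linear operator from $\mathcal X$ to $\mathcal Y$ with domain $\mathrm{dom}(L)$; $L^*$ is its adjoint with domain $\mathrm{dom}(L^* )$. (iii) There is a constant $c_0>0$ such that $\|Ax\|^2+\|Lx\|^2\ge c_0\|x\|^2$ for all $x\in\mathrm{dom}(L)$. (iv) $f:\mathcal Y\to(-\infty,\infty]$ is proper, lower semi-continuous and strongly convex, i.e. there is $s>0$ with $f(tx+(1-t)y)+s\,t(1-t)\|x-y\|^2\le tf(x)+(1-t)f(y)$ for all $x,y\in\mathrm{dom}(f)$, $0\le t\le1$. The exact data $b\in\mathcal H$ is consistent if there is $\hat x\in\mathrm{dom}(L)\cap\mathcal C$ with $L\hat x\in\mathrm{dom}(f)$ and $A\hat x=b$; in that case the problem $\min\{f(Lx):Ax=b,\ x\in\mathcal C,\ x\in\mathrm{dom}(L)\}$ has a unique solution. $\iota_{\mathcal C}$ is the indicator function of $\mathcal C$ ($0$ on $\mathcal C$, $+\infty$ elsewhere), $\partial$ the convex subdifferential, $\mathrm{Ran}(A^* )$ the range of $A^*$, $\|u\|_Q^2:=\langle u,Qu\rangle$. Proximal ADMM. Fix $\rho_1,\rho_2,\rho_3>0$ and set $$\mathscr L(z,y,x,\lambda,\mu,\nu):=f(y)+\iota_{\mathcal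 C}(x)+\langle\lambda,Az-b^\delta\rangle+\langle\mu,Lz-y\rangle+\langle\nu,z-x\rangle+\tfrac{\rho_1}2\|Az-b^\delta\|^2+\tfrac{\rho_2}2\|Lz-y\|^2+\tfrac{\rho_3}2\|z-x\|^2 .$$ From initial guesses $z^0,x^0,\nu^0\in\mathcal X$, $y^0,\mu^0\in\mathcal Y$, $\lambda^0\in\mathcal H$ (fixed, independent of $\delta$ and $b^\delta$), for $k\ge0$ define $$z^{k+1}=\arg\min_{z\in\mathrm{dom}(L)}\Big\{\mathscr L(z,y^k,x^k,\lambda^k,\mu^k,\nu^k)+\tfrac12\|z-z^k\|_Q^2\Big\},$$ $$y^{k+1}=\arg\min_{y\in\mathcal Y}\mathscr L(z^{k+1},y,x^k,\lambda^k,\mu^k,\nu^k),\qquad x^{k+1}=\arg\min_{x\in\mathcal X}\mathscr L(z^{k+1},y^{k+1},x,\lambda^k,\mu^k,\nu^k),$$ $$\lambda^{k+1}=\lambda^k+\rho_1(Az^{k+1}-b^\delta),\quad \mu^{k+1}=\mu^k+\rho_2(Lz^{k+1}-y^{k+1}),\quad \nu^{k+1}=\nu^k+\rho_3(z^{k+1}-x^{k+1}).$$ Under assumptions (i)–(iv) these iterates are well defined. The iterates depend on $b^\delta$. The notation $k_\delta\sim\delta^{-1}$ means there are constants $0<a_1\le a_2$ independent of $\delta$ with $a_1\delta^{-1}\le k_\delta\le a_2\delta^{-1}$; the constants in $O(\cdot)$ are independent of $\delta$. *)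

(* Defs.v *)
From HB Require Import structures.
From mathcomp Require Import all_boot all_order all_algebra.
From mathcomp Require Import all_classical all_reals all_analysis.

Set Implicit Arguments.
Unset Strict Implicit.
Unset Printing Implicit Defensive.

Import Order.TTheory GRing.Theory Num.Theory.
Import numFieldNormedType.Exports.

Local Open Scope classical_set_scope.
Local Open Scope ring_scope.

(* [inner] is the library's positive definite symmetric bilinear form; the last
   field makes the given complete norm the one it induces. *)
HB.mixin Record isHilbert (R : realType) (V : Type)
    of CompleteNormedModule R V := {
  inner : {dot V for (@idfun R)} ;
  inner_norm : forall x : V, inner x x = `|x| ^+ 2
}.

#[short(type="hilbertType")]
HB.structure Definition Hilbert (R : realType) :=
  {V of CompleteNormedModule R V & isHilbert R V}.

Notation "''[' u , v ]" := (inner u v) : ring_scope.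

Section operators.
Context {R : realType}.

Definition bounded_operator {V W : normedModType R} (T : {linear V -> W}) :=
  bounded_near T (nbhs (0 : V)).

Definition self_adjoint {V : hilbertType R} (T : V -> V) :=
  forall u v, '[T u, v] = '[u, T v].

Definition positive_semidefinite {V : hilbertType R} (T : V -> V) :=
  forall u, 0 <= '[u, T u].

(* A linear operator whose domain is a subspace of [V]; the values of [plin_fun]
   off [dom] are junk. *)
Record partial_linear (V W : normedModType R) := PartialLinear {
  dom : set V ;
  plin_fun :> V -> W ;
  dom0 : dom 0 ;
  domP : forall (a : R) u v, dom u -> dom v -> dom (a *: u + v) ;
  plin_funP : forall (a : R) u v, dom u -> dom v ->
    plin_fun (a *: u + v) = a *: plin_fun u + plin_fun v
}.

Definition densely_defined {V W : normedModType R} (T : partial_linear V W) :=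
  dense (dom T).

Definition graph_of {V W : normedModType R} (T : partial_linear V W) :
  set (V * W) := [set p | dom T p.1 /\ p.2 = T p.1].

Definition closed_operator {V W : normedModType R} (T : partial_linear V W) :=
  closed (graph_of T).

(* Adjoint of an operator [T] with dense domain [D]: [w] is [T^* v]. *)
Definition is_adjoint {V W : hilbertType R} (D : set V) (T : V -> W)
    (v : W) (w : V) :=
  forall u, D u -> '[T u, v] = '[u, w].

Definition dom_adjoint {V W : hilbertType R} (D : set V) (T : V -> W) : set W :=
  [set v | exists w, is_adjoint D T v w].

(* On [dom_adjoint D T], unique when [D] is dense; junk value 0 elsewhere. *)
Definition adjoint {V W : hilbertType R} (D : set V) (T : V -> W) (v : W) : V :=
  xget 0 [set w | is_adjoint D T v w].

End operators.

Section convex_analysis.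
Context {R : realType}.
Local Open Scope ereal_scope.

Definition effdom {V : Type} (f : V -> \bar R) : set V := [set v | f v < +oo].

Definition proper_function {V : Type} (f : V -> \bar R) :=
  (forall v, -oo < f v) /\ effdom f !=set0.

Definition strongly_convex {V : normedModType R} (s : R) (f : V -> \bar R) :=
  forall (x y : V) (t : R), effdom f x -> effdom f y -> (0 <= t <= 1)%R ->
    f (t *: x + (1 - t) *: y)%R + (s * t * (1 - t) * `|x - y| ^+ 2)%:E <=
    t%:E * f x + (1 - t)%:E * f y.

Definition subdifferential {V : hilbertType R} (f : V -> \bar R) (x : V) :
  set V := [set xi | forall u, f x + '[xi, u - x]%:E <= f u].

Definition indicator {V : Type} (C : set V) (x : V) : \bar R :=
  if x \in C then 0 else +oo.

Definition argmin {T : Type} (D : set T) (F : T -> \bar R) : set T :=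
  [set u | D u /\ forall v, D v -> F u <= F v].

Lemma argmin_addl {T : Type} (D : set T) (c : \bar R) (F : T -> \bar R) :
  c \is a fin_num -> argmin D (fun u => c + F u) = argmin D F.
Proof.
move=> cfin; apply/seteqP; split=> u [Du minu]; split=> // v Dv.
  by move: (minu v Dv); rewrite leeD2lE.
by rewrite leeD2lE //; exact: minu.
Qed.

End convex_analysis.

Section proximal_admm.
Context {R : realType} {X Y H : hilbertType R}.
Variables (A : {linear X -> H}) (L : partial_linear X Y) (Q : {linear X -> X}).
Variables (rho1 rho2 rho3 : R).

Definition augmented_lagrangian (f : Y -> \bar R) (g : X -> \bar R) (bd : H)
    (z : X) (y : Y) (x : X) (lam : H) (mu : Y) (nu : X) : \bar R :=
  (f y + g x +
   ('[lam, A z - bd] + '[mu, L z - y] + '[nu, z - x]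
    + rho1 / 2 * `|A z - bd| ^+ 2
    + rho2 / 2 * `|L z - y| ^+ 2
    + rho3 / 2 * `|z - x| ^+ 2)%:E)%E.

(* In each minimization the terms of the Lagrangian that do not involve the
   current variable are constants and are dropped where they may be infinite:
   the initial [y^0] need not lie in dom f, nor [x^0] in C, and a constant +oo
   would make every point a minimizer. See [z_step_lagrangian] and
   [y_step_lagrangian] for the cases where these constants are finite. *)
Definition z_step (bd : H) (zk : X) (y : Y) (x : X) (lam : H) (mu : Y)
    (nu : X) : set X :=
  argmin (dom L) (fun z =>
    (augmented_lagrangian (cst 0) (cst 0) bd z y x lam mu nu
     + (2^-1 * '[z - zk, Q (z - zk)])%:E)%E).

Definition y_step (f : Y -> \bar R) (bd : H) (z x : X) (lam : H) (mu : Y)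
    (nu : X) : set Y :=
  argmin setT (fun y => augmented_lagrangian f (cst 0%E) bd z y x lam mu nu).

Definition x_step (f : Y -> \bar R) (C : set X) (bd : H) (z : X) (y : Y)
    (lam : H) (mu : Y) (nu : X) : set X :=
  argmin setT
    (fun x => augmented_lagrangian f (indicator C) bd z y x lam mu nu).

Lemma z_step_lagrangian f C bd zk y x lam mu nu :
  f y \is a fin_num -> C x ->
  z_step bd zk y x lam mu nu = argmin (dom L) (fun z =>
    (augmented_lagrangian f (indicator C) bd z y x lam mu nu
     + (2^-1 * '[z - zk, Q (z - zk)])%:E)%E).
Proof.
move=> fy Cx; rewrite /z_step -[LHS](argmin_addl _ _ fy); congr argmin.
apply/funext => z; rewrite /augmented_lagrangian /indicator mem_set //=.
by rewrite !add0e !adde0 addeA.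
Qed.

Lemma y_step_lagrangian f C bd z x lam mu nu : C x ->
  y_step f bd z x lam mu nu = argmin setT (fun y =>
    augmented_lagrangian f (indicator C) bd z y x lam mu nu).
Proof.
move=> Cx; congr argmin; apply/funext => y.
by rewrite /augmented_lagrangian /indicator mem_set.
Qed.

Definition is_proximal_admm (f : Y -> \bar R) (C : set X) (bd : H)
    (z0 : X) (y0 : Y) (x0 : X) (lam0 : H) (mu0 : Y) (nu0 : X)
    (z : nat -> X) (y : nat -> Y) (x : nat -> X)
    (lam : nat -> H) (mu : nat -> Y) (nu : nat -> X) :=
  [/\ [/\ z 0%N = z0, y 0%N = y0 & x 0%N = x0],
      [/\ lam 0%N = lam0, mu 0%N = mu0 & nu 0%N = nu0] &
      forall k,
      [/\ z_step bd (z k) (y k) (x k) (lam k) (mu k) (nu k) (z k.+1),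
          y_step f bd (z k.+1) (x k) (lam k) (mu k) (nu k) (y k.+1),
          x_step f C bd (z k.+1) (y k.+1) (lam k) (mu k) (nu k) (x k.+1) &
        [/\ lam k.+1 = lam k + rho1 *: (A (z k.+1) - bd),
            mu k.+1 = mu k + rho2 *: (L (z k.+1) - y k.+1) &
            nu k.+1 = nu k + rho3 *: (z k.+1 - x k.+1)]]].

End proximal_admm.

Definition sim_inverse {R : realType} (k : R -> nat) :=
  exists a1 a2 : R, [/\ 0 < a1, a1 <= a2 &
    \forall delta \near (0 : R)^'+,
      a1 * delta^-1 <= (k delta)%:R <= a2 * delta^-1].

(* Main.v *)
Require Import Defs.
From mathcomp Require Import all_boot all_order all_algebra.
From mathcomp Require Import all_classical all_reals all_analysis.
From mathcomp Require Import ring lra.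

Set Implicit Arguments.
Unset Strict Implicit.
Unset Printing Implicit Defensive.

Import Order.TTheory GRing.Theory Num.Theory.
Import numFieldNormedType.Exports.

Local Open Scope classical_set_scope.
Local Open Scope ring_scope.

(** A solution satisfying the source condition has Lagrange multipliers, and
    together they form a primal-dual state fixed by the noise-free iteration.
    Both the error of an iterate and the increment between two consecutive
    iterates are therefore differences of two ADMM orbits, and the same estimate
    applies to both.  The iteration is a linear step (the Euler equation of the
    [z]-minimization and the multiplier updates, [linear_step]) combined with two
    subgradient inclusions ([y_step_subgradient], [x_step_subgradient]).  Testing
    the linear step with its own [z]-component gives an exact identity
    ([energy_identity]) for the weighted energy
    [|lam|^2/rho1 + |mu|^2/rho2 + |nu|^2/rho3 + rho2 |y|^2 + rho3 |x|^2 + |z|_Q^2].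

    Monotonicity of the subdifferentials makes the energy of a difference of two
    orbits nonincreasing up to the noise.  For the error, the noise adds at most
    [O(delta)] per step to the square root of the energy, which thus stays bounded
    during [O(1/delta)] steps ([sqrt_energy_growth]).  For the increments, the
    noise cancels and their energy is nonincreasing
    ([incr_energy_nonincreasing]).  Every step also dissipates the energy of its
    increment, so the last of [k] increments has energy [O(1/k)], that is
    [O(delta)] when [k] is of order [1/delta] ([incr_energy_sum]).

    The strong convexity of [f] enters the same identity: [s |y - y_dag|^2] is
    bounded by the inner product of the error and the increment in the energy
    form, plus noise, hence by [sqrt(O(1)) * sqrt(O(delta))].  This is the rate
    [delta^(1/4)] for [y].  The multiplier updates express the residuals
    [A z - bd], [L z - y] and [z - x] through the increments, which transfers the
    rate to [z] by coercivity, and then to [x] ([orbit_uniform_rate]). *)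

(** * Inner products *)

Section inner_product.
Context {R : realType} {V : hilbertType R}.
Implicit Types (u v w : V) (a : R).

Lemma innerC u v : '[u, v] = '[v, u].
Proof. by rewrite hermC expr0 mul1r. Qed.

Lemma innerDl u v w : '[u + v, w] = '[u, w] + '[v, w].
Proof. exact: linearDl. Qed.

Lemma innerDr u v w : '[w, u + v] = '[w, u] + '[w, v].
Proof. exact: linearDr. Qed.

Lemma innerZl a u v : '[a *: u, v] = a * '[u, v].
Proof. exact: linearZl_LR. Qed.

Lemma innerZr a u v : '[v, a *: u] = a * '[v, u].
Proof. by rewrite innerC innerZl innerC. Qed.

Lemma innerNl u v : '[- u, v] = - '[u, v].
Proof. by rewrite -scaleN1r innerZl mulN1r. Qed.

Lemma innerNr u v : '[v, - u] = - '[v, u].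
Proof. by rewrite innerC innerNl innerC. Qed.

Lemma inner0l u : '[0, u] = 0.
Proof. by rewrite -(scale0r 0) innerZl mul0r. Qed.

Lemma inner0r u : '[u, 0] = 0.
Proof. by rewrite innerC inner0l. Qed.

Definition innerE := (innerDl, innerDr, innerZl, innerZr, innerNl, innerNr).

Lemma inner_ge0 u : 0 <= '[u, u].
Proof. by rewrite inner_norm sqr_ge0. Qed.

Lemma cauchy_schwarz u v : '[u, v] <= `|u| * `|v|.
Proof.
have [u0|u_neq0] := eqVneq u 0; first by rewrite u0 inner0l normr0 mul0r.
have [v0|v_neq0] := eqVneq v 0; first by rewrite v0 inner0r normr0 mulr0.
have uv_gt0 : 0 < `|u| * `|v| by rewrite mulr_gt0 ?normr_gt0.
have := inner_ge0 (`|v| *: u - `|u| *: v).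
rewrite !innerE !inner_norm (innerC v u) => sq_ge0.
by rewrite -(ler_pM2l uv_gt0); nra.
Qed.

(** The right-hand side is [|v + rho u|^2 / rho]. With [u] and [v] the increments
    of a primal variable and of its multiplier, it lets the squares in the energy
    absorb their product. *)
Lemma cross_term_ge0 rho u v : 0 < rho ->
  0 <= rho^-1 * '[v, v] + rho * '[u, u] + 2 * '[u, v].
Proof.
move=> rho_gt0; have := inner_ge0 (v + rho *: u).
rewrite !innerE (innerC v u) => sq_ge0.
rewrite -(pmulr_rge0 _ rho_gt0) !mulrDr mulVKf ?gt_eqF//.
by move: sq_ge0; congr (_ <= _); ring.
Qed.

Lemma sqr_normD_le u v : `|u + v| ^+ 2 <= 2 * `|u| ^+ 2 + 2 * `|v| ^+ 2.
Proof.
have := inner_ge0 (u - v); rewrite -!inner_norm !innerE; lra.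
Qed.

End inner_product.

(** * Variational characterization of the three minimizations *)

(** At a small multiple [t] of [- g] the linear term would be negative and of
    larger size than the quadratic one. *)
Lemma linear_part_eq0 {R : realType} (g q : R) :
  (forall t, 0 <= t * g + t ^+ 2 * q) -> g = 0.
Proof.
move=> ge0; apply/eqP; apply: contraT => g_neq0.
have q1_gt0 : 0 < `|q| + 1 by rewrite ltr_wpDl.
have /= := ge0 (- g / (`|q| + 1)); set t := _ / _ => t_ge0.
have gE : g = - t * (`|q| + 1) by rewrite /t; field; rewrite gt_eqF.
have t_neq0 : t != 0.
  by apply: contraNneq g_neq0 => t0; rewrite gE t0 oppr0 mul0r.
have : 0 < t ^+ 2 by rewrite exprn_even_gt0.
have := ler_norm q; move: t_ge0; rewrite gE; nra.
Qed.

(** With [t] confined to the interval used in convexity inequalities, the same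
    choice of [t] excludes only a negative [g]. *)
Lemma nonneg_slope {R : realType} (g q : R) :
  (forall t, 0 < t <= 1 -> 0 <= t * g + t ^+ 2 * q) -> 0 <= g.
Proof.
move=> ge0; rewrite leNgt; apply/negP => g_lt0.
have D_gt0 : 0 < 1 + `|q| - g by have := normr_ge0 q; lra.
have /= := ge0 (- g / (1 + `|q| - g)); set t := _ / _ => t_ge0.
have gE : g = - t * (1 + `|q| - g) by rewrite /t; field; rewrite gt_eqF.
have t_gt0 : 0 < t by rewrite /t divr_gt0// oppr_gt0.
have t_le1 : t <= 1.
  by rewrite /t ler_pdivrMr// mul1r; have := normr_ge0 q; lra.
have {}t_ge0 := t_ge0 _; rewrite t_gt0 t_le1 in t_ge0.
have {}t_ge0 := t_ge0 isT.
have t2_gt0 : 0 < t ^+ 2 by rewrite exprn_gt0.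
have := ler_norm q; move: t_ge0; rewrite {1}gE; nra.
Qed.

(** The subgradient inequality improved by the modulus [s] of convexity; it is
    stated in [R], on the effective domain, so that inequalities at two points
    can be added. *)
Definition strong_subgradient {R : realType} {V : hilbertType R} (s : R)
    (F : V -> \bar R) (u xi : V) :=
  effdom F u /\ forall v, effdom F v ->
    fine (F u) + '[xi, v - u] + s * `|v - u| ^+ 2 <= fine (F v).

Section strong_subgradients.
Context {R : realType} {V : hilbertType R}.
Implicit Types (F : V -> \bar R) (u v xi : V).

Lemma effdom_fin_num F v : proper_function F -> effdom F v -> F v \is a fin_num.
Proof. by move=> [F_gt _] Fv; rewrite fin_real// F_gt. Qed.

Lemma strong_subgradient_monotone F (s s' : R) u v xi eta :
  strong_subgradient s F u xi -> strong_subgradient s' F v eta ->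
  (s + s') * `|u - v| ^+ 2 <= '[xi - eta, u - v].
Proof.
move=> [Fu /(_ v) uv] [Fv /(_ u) vu].
move: (uv Fv) (vu Fu); rewrite -(distrC u v) !innerE; lra.
Qed.

Lemma subdifferential_strong_subgradient F u xi :
  proper_function F -> effdom F u -> subdifferential F u xi ->
  strong_subgradient 0 F u xi.
Proof.
move=> F_proper Fu xi_sub; split=> // v Fv.
have := xi_sub v.
rewrite -(fineK (effdom_fin_num F_proper Fu)).
rewrite -(fineK (effdom_fin_num F_proper Fv)) -EFinD lee_fin; lra.
Qed.

(** Comparing the minimizer with points [t] of the way to [v] and letting [t]
    tend to [0] shows that the updated multiplier is a subgradient at the
    minimizer, with the full modulus [s]. *)
Lemma prox_strong_subgradient F (s rho : R) (m p u : V) :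
  proper_function F -> strongly_convex s F ->
  (forall v, (F u + ('[m, p - u] + rho / 2 * `|p - u| ^+ 2)%:E <=
              F v + ('[m, p - v] + rho / 2 * `|p - v| ^+ 2)%:E)%E) ->
  strong_subgradient s F u (m + rho *: (p - u)).
Proof.
move=> F_proper F_sconvex u_min.
have Fu : effdom F u.
  have [w Fw] := F_proper.2; have := u_min w.
  rewrite -(fineK (effdom_fin_num F_proper Fw)) -EFinD.
  move=> /le_lt_trans/(_ (ltry _)); rewrite /effdom /=.
  by case: (F u) => [r _|/=|/=]; rewrite ?ltry.
split=> // v Fv.
set d := v - u.
suff : 0 <= fine (F v) - fine (F u) - '[m + rho *: (p - u), d]
            - s * `|d| ^+ 2 by lra.
apply: (@nonneg_slope _ _ ((rho / 2 + s) * `|d| ^+ 2)) => t /andP[t_gt0 t_le1].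
have := F_sconvex v u t Fv Fu; rewrite (ltW t_gt0) t_le1 => /(_ isT).
have -> : t *: v + (1 - t) *: u = u + t *: d.
  by rewrite /d scalerBl scale1r scalerBr addrCA.
have := u_min (u + t *: d).
rewrite -(fineK (effdom_fin_num F_proper Fu)).
rewrite -(fineK (effdom_fin_num F_proper Fv)).
have := F_proper.1 (u + t *: d).
case: (F (u + t *: d)) => [r _||]//=; rewrite ?lee_fin.
rewrite -/d opprD addrA -!inner_norm !innerE.
rewrite (innerC u p) (innerC v p) (innerC v u); lra.
Qed.

End strong_subgradients.

Section indicator_function.
Context {R : realType} {V : hilbertType R}.
Variable C : set V.
Local Notation iC := (indicator C : V -> \bar R).

Lemma effdom_indicator : effdom iC = C.
Proof.
apply/seteqP; split=> v; rewrite /effdom /indicator /=.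
  by case: ifPn => // /set_mem.
by move=> Cv; rewrite mem_set.
Qed.

Lemma indicator_proper : C !=set0 -> proper_function iC.
Proof.
move=> C_neq0; split; last by rewrite effdom_indicator.
by move=> v; rewrite /indicator; case: ifP.
Qed.

Lemma indicator_strongly_convex : convex_set C -> strongly_convex 0 iC.
Proof.
move=> C_convex x y t; rewrite !effdom_indicator => Cx Cy t01.
rewrite !mul0r adde0 /indicator !mem_set// ?mule0 ?adde0//.
have /andP[t_ge0 t_le1] := t01.
have := C_convex x y (Itv01 t_ge0 t_le1); rewrite !inE => /(_ Cx Cy).
by [].
Qed.

End indicator_function.

(** * ADMM steps between primal-dual states *)

Section partial_linear_theory.
Context {R : realType} {V W : normedModType R} (T : partial_linear V W).

Lemma dom_add_scale a u v : dom T u -> dom T v -> dom T (u + a *: v).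
Proof. by move=> Tu Tv; rewrite addrC; exact: domP. Qed.

Lemma plin_add_scale a u v : dom T u -> dom T v -> T (u + a *: v) = T u + a *: T v.
Proof. by move=> Tu Tv; rewrite addrC plin_funP// addrC. Qed.

Lemma dom_sub u v : dom T u -> dom T v -> dom T (u - v).
Proof. by rewrite -(scaleN1r v); exact: dom_add_scale. Qed.

Lemma plin_sub u v : dom T u -> dom T v -> T (u - v) = T u - T v.
Proof. by move=> Tu Tv; rewrite -(scaleN1r v) -(scaleN1r (T v)) plin_add_scale. Qed.

End partial_linear_theory.

Lemma affine_updateB {R : realType} {V : lmodType R} (c : R) (u u' a a' e e' : V) :
  (u + c *: (a - e)) - (u' + c *: (a' - e')) =
  (u - u') + c *: ((a - a') - (e - e')).
Proof. by rewrite opprD addrACA -scalerBr !opprD addrACA. Qed.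

Record state {R : realType} (X Y H : hilbertType R) :=
  State { zv : X; yv : Y; xv : X; lv : H; mv : Y; nv : X }.
Arguments State {R X Y H}.
Arguments zv {R X Y H}. Arguments yv {R X Y H}. Arguments xv {R X Y H}.
Arguments lv {R X Y H}. Arguments mv {R X Y H}. Arguments nv {R X Y H}.

Definition sub_state {R : realType} {X Y H : hilbertType R} (w v : state X Y H) :=
  State (zv w - zv v) (yv w - yv v) (xv w - xv v)
        (lv w - lv v) (mv w - mv v) (nv w - nv v).

Lemma sub_stateBB {R : realType} {X Y H : hilbertType R} (w v u : state X Y H) :
  sub_state (sub_state w u) (sub_state v u) = sub_state w v.
Proof. by rewrite /sub_state /= !opprB !addrA !subrK. Qed.

Section steps.
Context {R : realType} {X Y H : hilbertType R}.
Variables (A : {linear X -> H}) (L : partial_linear X Y) (Q : {linear X -> X}).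
Variables rho1 rho2 rho3 : R.
Hypotheses (rho1_gt0 : 0 < rho1) (rho2_gt0 : 0 < rho2) (rho3_gt0 : 0 < rho3).
Hypotheses (Q_selfadjoint : self_adjoint Q) (Q_psd : positive_semidefinite Q).
Implicit Types (o p w v : state X Y H) (r : H).

Lemma Q_innerC (u v : X) : '[v, Q u] = '[u, Q v].
Proof. by rewrite -Q_selfadjoint innerC. Qed.

(** The part of an ADMM step that is linear in the data and in both states: the
    Euler equation of the [z]-minimization, in which the updated multipliers
    have been substituted, and the multiplier updates. The nonlinear part is
    the pair of subgradient inclusions for [y] and [x]. *)
Definition linear_step r o p :=
  [/\ dom L (zv p),
      [/\ lv p = lv o + rho1 *: (A (zv p) - r),
          mv p = mv o + rho2 *: (L (zv p) - yv p) &
          nv p = nv o + rho3 *: (zv p - xv p)] &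
      forall h, dom L h ->
        '[lv p, A h] + '[mv p + rho2 *: (yv p - yv o), L h]
        + '[nv p + rho3 *: (xv p - xv o), h] + '[Q (zv p - zv o), h] = 0].

(** Linearity lets one estimate serve both for the distance of an iterate to a
    solution and for the distance between consecutive iterates. *)
Lemma linear_stepB r o p r' o' p' :
  linear_step r o p -> linear_step r' o' p' ->
  linear_step (r - r') (sub_state o o') (sub_state p p').
Proof.
move=> [dp [pl pm pn] popt] [dp' [pl' pm' pn'] popt'].
rewrite /linear_step /=; split; first exact: dom_sub.
- rewrite plin_sub// (raddfB A) pl pl' pm pm' pn pn'.
  by split; exact: affine_updateB.
- move=> h dh; have := popt h dh; have := popt' h dh.
  rewrite !(raddfB Q) !innerE; lra.
Qed.

(** The weights are those for which the Euler equation of an increment [d] of [p],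
    tested with [zv p], contains exactly [energy_form p d]. *)
Definition energy_form w v : R :=
  rho1^-1 * '[lv w, lv v] + rho2^-1 * '[mv w, mv v] + rho3^-1 * '[nv w, nv v]
  + rho2 * '[yv w, yv v] + rho3 * '[xv w, xv v] + '[zv w, Q (zv v)].

Definition energy w : R := energy_form w w.

Lemma energy_bounds w :
  [/\ 0 <= energy w, '[lv w, lv w] <= rho1 * energy w,
      '[mv w, mv w] <= rho2 * energy w & '[nv w, nv w] <= rho3 * energy w].
Proof.
have [i1 i2 i3] : [/\ 0 < rho1^-1, 0 < rho2^-1 & 0 < rho3^-1].
  by split; rewrite invr_gt0.
have l_ge0 : 0 <= rho1^-1 * '[lv w, lv w] by rewrite mulr_ge0 ?inner_ge0 ?ltW.
have m_ge0 : 0 <= rho2^-1 * '[mv w, mv w] by rewrite mulr_ge0 ?inner_ge0 ?ltW.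
have n_ge0 : 0 <= rho3^-1 * '[nv w, nv w] by rewrite mulr_ge0 ?inner_ge0 ?ltW.
have y_ge0 : 0 <= rho2 * '[yv w, yv w] by rewrite mulr_ge0 ?inner_ge0 ?ltW.
have x_ge0 : 0 <= rho3 * '[xv w, xv w] by rewrite mulr_ge0 ?inner_ge0 ?ltW.
have z_ge0 := Q_psd (zv w).
rewrite -!ler_pdivrMl// /energy /energy_form; split; lra.
Qed.

Lemma energy_ge0 w : 0 <= energy w.
Proof. by have [] := energy_bounds w. Qed.

Lemma energy_polarization p o :
  2 * energy_form p (sub_state p o) =
  energy p - energy o + energy (sub_state p o).
Proof.
rewrite /energy /energy_form /= !(raddfB Q) !innerE (Q_innerC (zv o) (zv p)).
rewrite (innerC (lv o)) (innerC (mv o)) (innerC (nv o)) (innerC (yv o)).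
by rewrite (innerC (xv o)); ring.
Qed.

(** A weighted Cauchy-Schwarz inequality, from the nonnegativity of the energy
    of [t p + d]. *)
Lemma energy_form_young p d (t : R) : 0 < t ->
  - 2 * energy_form p d <= t * energy p + t^-1 * energy d.
Proof.
move=> t_gt0.
have := energy_ge0 (State (t *: zv p + zv d) (t *: yv p + yv d)
  (t *: xv p + xv d) (t *: lv p + lv d) (t *: mv p + mv d) (t *: nv p + nv d)).
have -> : energy (State (t *: zv p + zv d) (t *: yv p + yv d)
    (t *: xv p + xv d) (t *: lv p + lv d) (t *: mv p + mv d)
    (t *: nv p + nv d)) =
    t * (t * energy p) + t * (2 * energy_form p d) + energy d.
  rewrite /energy /energy_form /= (raddfD Q) /= (linearZZ Q) /= !innerE.
  rewrite (Q_innerC (zv p) (zv d)).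
  rewrite (innerC (lv d) (lv p)) (innerC (mv d) (mv p)) (innerC (nv d) (nv p)).
  by rewrite (innerC (yv d) (yv p)) (innerC (xv d) (xv p)); ring.
move=> sum_ge0.
by rewrite -(ler_pM2l t_gt0) [leRHS]mulrDr mulVKf ?gt_eqF//; lra.
Qed.

(** The Euler equation is tested with [h = zv p]; the multiplier updates then
    replace [A (zv p)], [L (zv p)] and [zv p] by the multiplier increments plus
    [r], [yv p] and [xv p]. *)
Lemma energy_identity r o p (d := sub_state p o) :
  linear_step r o p ->
  energy_form p d + '[mv p, yv p] + '[nv p, xv p]
  + '[yv d, mv d] + '[xv d, nv d] + '[lv p, r] = 0.
Proof.
move=> [dp [pl pm pn] popt].
have Az : A (zv p) = rho1^-1 *: lv d + r.
  by rewrite /d /= pl addrAC subrr add0r scalerA mulVf ?gt_eqF// scale1r subrK.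
have Lz : L (zv p) = rho2^-1 *: mv d + yv p.
  by rewrite /d /= pm addrAC subrr add0r scalerA mulVf ?gt_eqF// scale1r subrK.
have z_eq : zv p = rho3^-1 *: nv d + xv p.
  by rewrite /d /= pn addrAC subrr add0r scalerA mulVf ?gt_eqF// scale1r subrK.
have z_term : '[nv p + rho3 *: xv d, zv p] =
    '[nv p + rho3 *: xv d, rho3^-1 *: nv d + xv p] by rewrite -z_eq.
have := popt _ dp; rewrite Q_selfadjoint Q_innerC.
rewrite -[yv p - yv o]/(yv d) -[xv p - xv o]/(xv d) -[zv p - zv o]/(zv d).
rewrite z_term Az Lz /energy_form; clearbody d; rewrite !innerE => popt0.
rewrite -[RHS]popt0 (innerC (yv p) (yv d)) (innerC (xv p) (xv d)).
by field; rewrite !gt_eqF.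
Qed.

(** Besides the noise, the only terms of the identity without a sign are the
    products of increments; they are absorbed by the squares of those
    increments contained in [energy d]. *)
Lemma energy_le_step r o p : linear_step r o p ->
  0 <= '[mv p, yv p] -> 0 <= '[nv p, xv p] ->
  energy p <= energy o - 2 * '[lv p, r].
Proof.
move=> /energy_identity; have := energy_polarization p o.
set d := sub_state p o => pol id my_ge0 nx_ge0.
have ym_ge0 := cross_term_ge0 (yv d) (mv d) rho2_gt0.
have xn_ge0 := cross_term_ge0 (xv d) (nv d) rho3_gt0.
have l_ge0 : 0 <= rho1^-1 * '[lv d, lv d].
  by rewrite mulr_ge0 ?inner_ge0// invr_ge0 ltW.
have := erefl (energy d); rewrite {2}/energy {1}/energy_form => dE.
have := Q_psd (zv d); lra.
Qed.

(** When the increments are monotone as well, nothing has to be absorbed and the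
    whole of [energy d] is dissipated. *)
Lemma energy_decrease r o p (d := sub_state p o) : linear_step r o p ->
  0 <= '[mv p, yv p] -> 0 <= '[nv p, xv p] ->
  0 <= '[mv d, yv d] -> 0 <= '[nv d, xv d] ->
  energy p + energy d <= energy o - 2 * '[lv p, r].
Proof.
move=> /energy_identity; have := energy_polarization p o; rewrite -/d.
rewrite (innerC (yv d)) (innerC (xv d)); lra.
Qed.

(** The inner product of [mv p] and [yv p] controls [yv p] by strong convexity.
    It is estimated by the energy form of [p] and its increment: this retains the
    smallness of [energy d] even when [energy p] is only bounded. *)
Lemma energy_dissipation r o p (t : R) (d := sub_state p o) : linear_step r o p ->
  0 < t -> 0 <= '[nv p, xv p] -> 0 <= '[mv d, yv d] -> 0 <= '[nv d, xv d] ->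
  '[mv p, yv p] <= (t * energy p + t^-1 * energy d) / 2 - '[lv p, r].
Proof.
move=> /energy_identity + t_gt0; have := energy_form_young p d t_gt0.
rewrite -/d (innerC (yv d)) (innerC (xv d)); lra.
Qed.

Lemma noise_term_le p r delta : `|r| <= delta ->
  - '[lv p, r] <= delta * (Num.sqrt rho1 * Num.sqrt (energy p)).
Proof.
move=> r_le; rewrite -innerNr (le_trans (cauchy_schwarz _ _))// normrN mulrC.
apply: ler_pM => //; rewrite -sqrtrM ?(ltW rho1_gt0)//.
rewrite -(normr_id (lv p)) -sqrtr_sqr -inner_norm; apply: ler_wsqrtr.
by have [] := energy_bounds p.
Qed.

Lemma residual_bounds r o p (d := sub_state p o) : linear_step r o p ->
  [/\ `|A (zv p) - r| ^+ 2 <= rho1^-1 * energy d,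
      `|L (zv p) - yv p| ^+ 2 <= rho2^-1 * energy d &
      `|zv p - xv p| ^+ 2 <= rho3^-1 * energy d].
Proof.
move=> [_ [pl pm pn] _]; have [_] := energy_bounds d.
have scale (V : hilbertType R) (rho : R) (u : V) : 0 < rho ->
    '[rho *: u, rho *: u] <= rho * energy d -> `|u| ^+ 2 <= rho^-1 * energy d.
  move=> rho_gt0; rewrite innerZl ler_pM2l// innerZr inner_norm.
  by rewrite ler_pdivlMl.
rewrite /d /= pl pm pn ![_ + _ - _]addrAC !subrr !add0r.
by split; exact: scale.
Qed.

End steps.

(** * Orbits of the iteration around a solution *)

Section orbits.
Context {R : realType} {X Y H : hilbertType R}.
Variables (A : {linear X -> H}) (L : partial_linear X Y) (Q : {linear X -> X}).
Variables rho1 rho2 rho3 : R.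
Hypotheses (rho1_gt0 : 0 < rho1) (rho2_gt0 : 0 < rho2) (rho3_gt0 : 0 < rho3).
Hypotheses (Q_selfadjoint : self_adjoint Q) (Q_psd : positive_semidefinite Q).
Local Notation linear_step := (linear_step A L Q rho1 rho2 rho3).
Local Notation energy := (energy Q rho1 rho2 rho3).

Variables (s delta : R) (b bd : H) (wdag : state X Y H) (w : nat -> state X Y H).
Hypotheses (s_ge0 : 0 <= s) (delta_ge0 : 0 <= delta).
Let e n := sub_state (w n) wdag.
Let d n := sub_state (w n.+1) (w n).

(** The starting point [w 0] is arbitrary, so the monotonicity inequalities
    coming from the subgradient inclusions hold from index [1] on. *)
Record noisy_orbit := NoisyOrbit {
  orbit_noise : `|bd - b| <= delta ;
  orbit_fixed : linear_step b wdag wdag ;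
  orbit_step : forall n, linear_step bd (w n) (w n.+1) ;
  orbit_error_y : forall n,
    s * `|yv (e n.+1)| ^+ 2 <= '[mv (e n.+1), yv (e n.+1)] ;
  orbit_error_x : forall n, 0 <= '[nv (e n.+1), xv (e n.+1)] ;
  orbit_incr_y : forall n, 0 <= '[mv (d n.+1), yv (d n.+1)] ;
  orbit_incr_x : forall n, 0 <= '[nv (d n.+1), xv (d n.+1)] }.

Hypothesis w_orbit : noisy_orbit.

Let error_step n : linear_step (bd - b) (e n) (e n.+1).
Proof. exact: linear_stepB (orbit_step w_orbit n) (orbit_fixed w_orbit). Qed.

Let incr_step n : linear_step 0 (d n) (d n.+1).
Proof.
by rewrite -(subrr bd); exact: linear_stepB (orbit_step w_orbit _) (orbit_step w_orbit _).
Qed.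

Let error_incr n : sub_state (e n.+1) (e n) = d n.
Proof. exact: sub_stateBB. Qed.

Let my_ge0 n : 0 <= '[mv (e n.+1), yv (e n.+1)].
Proof.
by apply: le_trans (orbit_error_y w_orbit n); rewrite mulr_ge0 ?sqr_ge0.
Qed.

(** From [u^2 <= v^2 + 2 delta sqrt(rho1) u] one gets [u <= v + 2 delta sqrt(rho1)]:
    in the square root of the energy the noise accumulates only linearly. *)
Lemma sqrt_energy_growth n :
  Num.sqrt (energy (e n)) <=
  Num.sqrt (energy (e 0%N)) + 2 * (delta * Num.sqrt rho1) * n%:R.
Proof.
elim: n => [|n IHn]; first by rewrite mulr0 addr0.
rewrite -[n.+1%:R]natr1 mulrDr mulr1 addrA (le_trans _ (lerD IHn (lexx _)))//.
have E_le := energy_le_step rho1_gt0 rho2_gt0 rho3_gt0 Q_selfadjoint Q_psd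
  (error_step n) (my_ge0 n) (orbit_error_x w_orbit n).
have l_le := noise_term_le rho1_gt0 rho2_gt0 rho3_gt0 Q_psd (e n.+1)
  (orbit_noise w_orbit).
have E_ge0 k := energy_ge0 rho1_gt0 rho2_gt0 rho3_gt0 Q_psd (e k).
move: E_le l_le; rewrite -{1}(sqr_sqrtr (E_ge0 n.+1)) -{1}(sqr_sqrtr (E_ge0 n)).
move: (sqrtr_ge0 (energy (e n))) (sqrtr_ge0 (energy (e n.+1))) (sqrtr_ge0 rho1).
move: (Num.sqrt (energy (e n))) (Num.sqrt (energy (e n.+1))) (Num.sqrt rho1).
move=> v u c v_ge0 u_ge0 c_ge0 E_le l_le.
have dc_ge0 : 0 <= delta * c by rewrite mulr_ge0.
rewrite -lerBlDr; apply: contraT; rewrite -ltNge; nra.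
Qed.

(** Consecutive steps use the same data, so the noise cancels in the difference. *)
Lemma incr_energy_nonincreasing n : energy (d n.+1) <= energy (d n).
Proof.
have := energy_le_step rho1_gt0 rho2_gt0 rho3_gt0 Q_selfadjoint Q_psd
  (incr_step n) (orbit_incr_y w_orbit n) (orbit_incr_x w_orbit n).
by rewrite inner0r mulr0 subr0.
Qed.

(** Each step dissipates the energy of its increment; since these energies
    decrease, [n] times the last of them is bounded by their sum. *)
Lemma incr_energy_sum M n : 0 <= M ->
  (forall k, (k <= n.+1)%N -> Num.sqrt (energy (e k)) <= M) ->
  energy (e n.+1) + n%:R * energy (d n) <=
  M ^+ 2 + n%:R * (2 * delta * (Num.sqrt rho1 * M)).
Proof.
move=> M_ge0; elim: n => [|n IHn] E_le.
  rewrite !mul0r !addr0 -[leLHS]sqr_sqrtr; last exact: energy_ge0.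
  by rewrite ler_pXn2r ?nnegrE ?sqrtr_ge0 ?E_le.
have {}IHn := IHn (fun k k_le => E_le k (leqW k_le)).
have dec : energy (e n.+2) + energy (d n.+1) <=
           energy (e n.+1) - 2 * '[lv (e n.+2), bd - b].
  rewrite -(error_incr n.+1); apply: energy_decrease => //.
  - exact: orbit_error_x w_orbit _.
  - by rewrite error_incr; exact: orbit_incr_y w_orbit _.
  - by rewrite error_incr; exact: orbit_incr_x w_orbit _.
have l_le : - '[lv (e n.+2), bd - b] <= delta * (Num.sqrt rho1 * M).
  apply: le_trans (noise_term_le rho1_gt0 rho2_gt0 rho3_gt0 Q_psd _
    (orbit_noise w_orbit)) _.
  by rewrite ler_wpM2l// ler_wpM2l ?sqrtr_ge0// E_le.
have := ler_wpM2l (ler0n R n) (incr_energy_nonincreasing n).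
rewrite -[n.+1%:R]natr1; lra.
Qed.

End orbits.

(** The constant [K] is chosen before the noise level, which is written [q ^+ 4]
    so that all estimates are in powers of [q]. The Young parameter [q ^+ 2]
    balances the bounded energy of the error against the energy of the increment,
    which is of order [q ^+ 4]. *)
Lemma orbit_uniform_rate {R : realType} {X Y H : hilbertType R}
    (A : {linear X -> H}) (L : partial_linear X Y) (Q : {linear X -> X})
    (rho1 rho2 rho3 c0 s E0 a1 a2 : R) :
  0 < rho1 -> 0 < rho2 -> 0 < rho3 -> self_adjoint Q -> positive_semidefinite Q ->
  0 < c0 ->
  (forall x, dom L x -> c0 * `|x| ^+ 2 <= `|A x| ^+ 2 + `|L x| ^+ 2) ->
  0 < s -> 0 < a1 -> 0 <= a2 ->
  exists2 K : R, 0 <= K &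
    forall (q : R) (b bd : H) (wdag : state X Y H) (w : nat -> state X Y H) N,
      0 < q <= 1 -> noisy_orbit A L Q rho1 rho2 rho3 s (q ^+ 4) b bd wdag w ->
      energy Q rho1 rho2 rho3 (sub_state (w 0%N) wdag) <= E0 ->
      (1 < N)%N -> a1 <= q ^+ 4 * N%:R <= a2 ->
      [/\ `|xv (w N) - xv wdag| ^+ 2 <= K * q ^+ 2,
          `|yv (w N) - yv wdag| ^+ 2 <= K * q ^+ 2 &
          `|zv (w N) - zv wdag| ^+ 2 <= K * q ^+ 2].
Proof.
move=> rho1_gt0 rho2_gt0 rho3_gt0 Q_selfadjoint Q_psd c0_gt0 AL_coercive s_gt0.
move=> a1_gt0 a2_ge0.
pose c := Num.sqrt rho1.
have c_ge0 : 0 <= c := sqrtr_ge0 _.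
pose M := Num.sqrt E0 + 2 * (a2 * c).
have M_ge0 : 0 <= M by rewrite addr_ge0 ?sqrtr_ge0// !mulr_ge0.
pose D := 2 * (M ^+ 2 + 2 * a2 * (c * M)) / a1.
have D_ge0 : 0 <= D.
  by rewrite divr_ge0 ?(ltW a1_gt0)// mulr_ge0// addr_ge0 ?sqr_ge0// !mulr_ge0.
pose Ky := ((M ^+ 2 + D) / 2 + c * M) / s.
have Ky_ge0 : 0 <= Ky.
  by rewrite divr_ge0 ?(ltW s_gt0)// addr_ge0 ?mulr_ge0// addr_ge0 ?sqr_ge0.
pose Kz := (2 * (rho1^-1 * D) + 2 + 2 * (rho2^-1 * D) + 2 * Ky) / c0.
have [i1 i2 i3] : [/\ 0 <= rho1^-1, 0 <= rho2^-1 & 0 <= rho3^-1].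
  by rewrite !invr_ge0 !ltW.
have Kz_ge0 : 0 <= Kz.
  have := mulr_ge0 i1 D_ge0; have := mulr_ge0 i2 D_ge0 => D2_ge0 D1_ge0.
  by rewrite divr_ge0 ?(ltW c0_gt0)//; lra.
pose Kx := 2 * Kz + 2 * (rho3^-1 * D).
have Kx_ge0 : 0 <= Kx by have := mulr_ge0 i3 D_ge0; rewrite /Kx; lra.
exists (Kx + Ky + Kz); first by lra.
move=> q b bd wdag w N /andP[q_gt0 q_le1] w_orbit E0_ge N_gt1 /andP[N_ge N_le].
case: N N_gt1 N_ge N_le => [//|[//|n]] _ N_ge N_le.
set e := fun k => sub_state (w k) wdag.
set d := sub_state (w n.+2) (w n.+1).
have d_eq : sub_state (e n.+2) (e n.+1) = d := sub_stateBB _ _ _.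
have q2_gt0 : 0 < q ^+ 2 by rewrite exprn_gt0.
have q4_ge0 : 0 <= q ^+ 4 by rewrite exprn_ge0 ?ltW.
have E_le k : (k <= n.+2)%N -> Num.sqrt (energy Q rho1 rho2 rho3 (e k)) <= M.
  move=> k_le.
  apply: le_trans (sqrt_energy_growth rho1_gt0 rho2_gt0 rho3_gt0 Q_selfadjoint
    Q_psd (ltW s_gt0) q4_ge0 w_orbit k) _.
  rewrite lerD ?ler_wsqrtr// -mulrA ler_wpM2l// mulrAC ler_wpM2r//.
  by apply: le_trans N_le; rewrite ler_wpM2l// ler_nat.
have e_ge0 := energy_ge0 rho1_gt0 rho2_gt0 rho3_gt0 Q_psd.
have q4_le : q ^+ 4 <= q ^+ 2.
  by rewrite ler_wiXn2l// ltW.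
have Ed_ge0 := e_ge0 _ _ d.
have D_le : energy Q rho1 rho2 rho3 d <= D * q ^+ 4.
  have := incr_energy_sum rho1_gt0 rho2_gt0 rho3_gt0 Q_selfadjoint Q_psd
    (ltW s_gt0) q4_ge0 w_orbit (n := n.+1) M_ge0 E_le.
  have := e_ge0 _ _ (e n.+2); rewrite -/(e n.+2) -/d -/c => En_ge0 sum_le.
  have x_ge1 : 1 <= n.+1%:R :> R by rewrite ler1n.
  (* [n.+2 <= 2 * n.+1] turns the lower bound on [n.+2] into one on [n.+1], the
     number of increments that have been summed. *)
  move: N_ge N_le; rewrite -[n.+2%:R]natr1; move: sum_le x_ge1.
  move: (n.+1%:R : R) => x sum_le x_ge1 N_ge N_le.
  have cM_ge0 : 0 <= c * M by rewrite mulr_ge0.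
  have a2_le : x * q ^+ 4 * (c * M) <= a2 * (c * M) by rewrite ler_wpM2r//; lra.
  have xE_le : x * energy Q rho1 rho2 rho3 d <= M ^+ 2 + 2 * a2 * (c * M) by lra.
  have a1_le : a1 * energy Q rho1 rho2 rho3 d <=
               2 * (x * q ^+ 4) * energy Q rho1 rho2 rho3 d.
    by rewrite ler_wpM2r//; nra.
  have qE_le := ler_wpM2l q4_ge0 xE_le.
  rewrite /D mulrAC ler_pdivlMr//; lra.
have D_le2 : energy Q rho1 rho2 rho3 d <= D * q ^+ 2.
  by apply: le_trans D_le _; rewrite ler_wpM2l.
have r_le := orbit_noise w_orbit.
have step := linear_stepB (orbit_step w_orbit n.+1) (orbit_fixed w_orbit).
rewrite -/(e n.+2) -/(e n.+1) in step.
have y_le : `|yv (e n.+2)| ^+ 2 <= Ky * q ^+ 2.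
  have En_le : energy Q rho1 rho2 rho3 (e n.+2) <= M ^+ 2.
    rewrite -[leLHS]sqr_sqrtr ?e_ge0//.
    by rewrite ler_pXn2r ?nnegrE ?sqrtr_ge0 ?E_le.
  have := energy_dissipation rho1_gt0 rho2_gt0 rho3_gt0 Q_selfadjoint Q_psd
    step q2_gt0 (orbit_error_x w_orbit _).
  rewrite d_eq => /(_ (orbit_incr_y w_orbit _) (orbit_incr_x w_orbit _)).
  have l_le : - '[lv (e n.+2), bd - b] <= q ^+ 2 * (c * M).
    apply: le_trans (noise_term_le rho1_gt0 rho2_gt0 rho3_gt0 Q_psd _ r_le) _.
    by rewrite ler_pM// ?mulr_ge0 ?sqrtr_ge0// ler_wpM2l// E_le.
  have := orbit_error_y w_orbit n.+1; rewrite -/(e n.+2).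
  have : (q ^+ 2)^-1 * energy Q rho1 rho2 rho3 d <= D * q ^+ 2.
    by rewrite ler_pdivrMl// mulrCA -exprD.
  have := ler_wpM2l (ltW q2_gt0) En_le.
  move=> *; rewrite /Ky mulrAC ler_pdivlMr//; lra.
have [Az_le Lz_le xz_le] :=
  residual_bounds rho1_gt0 rho2_gt0 rho3_gt0 Q_psd step.
rewrite d_eq in Az_le Lz_le xz_le.
have z_le : `|zv (e n.+2)| ^+ 2 <= Kz * q ^+ 2.
  have [z_dom _ _] := step.
  have r2_le : `|bd - b| ^+ 2 <= q ^+ 2.
    apply: (@le_trans _ _ (q ^+ 4 ^+ 2)).
      by rewrite ler_pXn2r ?nnegrE.
    by rewrite -exprM ler_wiXn2l// ltW.
  have := sqr_normD_le (A (zv (e n.+2)) - (bd - b)) (bd - b).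
  have := sqr_normD_le (L (zv (e n.+2)) - yv (e n.+2)) (yv (e n.+2)).
  rewrite !subrK; have := AL_coercive _ z_dom.
  have := ler_wpM2l i1 D_le2; have := ler_wpM2l i2 D_le2.
  move=> *; rewrite /Kz mulrAC ler_pdivlMr//; lra.
have x_le : `|xv (e n.+2)| ^+ 2 <= Kx * q ^+ 2.
  have := sqr_normD_le (xv (e n.+2) - zv (e n.+2)) (zv (e n.+2)).
  rewrite subrK [`|xv _ - _|]distrC; have := ler_wpM2l i3 D_le2; rewrite /Kx; lra.
have q2_ge0 := ltW q2_gt0.
split; [apply: le_trans x_le _|apply: le_trans y_le _|apply: le_trans z_le _];
  by rewrite ler_wpM2r//; lra.
Qed.

(** * The iteration and the solution as orbits *)

Section admm_orbits.
Context {R : realType} {X Y H : hilbertType R}.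
Variables (A : {linear X -> H}) (L : partial_linear X Y) (Q : {linear X -> X}).
Variables rho1 rho2 rho3 : R.
Hypothesis Q_selfadjoint : self_adjoint Q.

Lemma z_step_euler bd zk y x lam mu nu z :
  z_step A L Q rho1 rho2 rho3 bd zk y x lam mu nu z ->
  dom L z /\ forall h, dom L h ->
    '[lam + rho1 *: (A z - bd), A h] + '[mu + rho2 *: (L z - y), L h]
    + '[nu + rho3 *: (z - x), h] + '[Q (z - zk), h] = 0.
Proof.
move=> [z_dom z_min]; split=> // h h_dom.
apply: (@linear_part_eq0 _ _ (rho1 / 2 * '[A h, A h] + rho2 / 2 * '[L h, L h]
  + rho3 / 2 * '[h, h] + 2^-1 * '[h, Q h])) => t.
have := z_min _ (dom_add_scale t z_dom h_dom).
rewrite /augmented_lagrangian /= !add0e -!EFinD lee_fin -!inner_norm.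
rewrite plin_add_scale// (raddfD A) /= (linearZZ A) /=.
rewrite -(subr_ge0 (_ + _)); congr (_ <= _).
have -> : z + t *: h - zk = (z - zk) + t *: h by rewrite addrAC.
rewrite (raddfD Q) /= (linearZZ Q) /= Q_selfadjoint.
have Qh := Q_selfadjoint h (z - zk); rewrite innerC in Qh.
move: (z - zk) Qh => u; rewrite !innerE => Qh.
rewrite -Qh.
rewrite (innerC (A h) (A z)) (innerC (A h) bd) (innerC bd (A z)).
rewrite (innerC (L h) (L z)) (innerC (L h) y) (innerC y (L z)).
rewrite (innerC h z) (innerC h x) (innerC x z).
by field.
Qed.

Section prox_steps.
Variables (V : hilbertType R) (F : V -> \bar R) (s rho : R).
Hypotheses (F_proper : proper_function F) (F_sconvex : strongly_convex s F).

(** The terms of the Lagrangian that are constant in the current variable enter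
    as [a] and [c]. *)
Lemma argmin_strong_subgradient (G : V -> \bar R) (a : \bar R) (c : R) (m p u : V) :
  a \is a fin_num ->
  (forall v, G v = (a + F v + (c + ('[m, p - v] + rho / 2 * `|p - v| ^+ 2))%:E)%E) ->
  argmin setT G u -> strong_subgradient s F u (m + rho *: (p - u)).
Proof.
move=> a_fin GE [_ u_min]; apply: prox_strong_subgradient => // v.
have := u_min v I.
by rewrite !GE !EFinD -!addeA !(addeCA (F _)) leeD2lE// leeD2lE// addeA.
Qed.

End prox_steps.

Variables (f : Y -> \bar R) (C : set X) (s : R).
Hypotheses (f_proper : proper_function f) (f_sconvex : strongly_convex s f).
Hypotheses (C_neq0 : C !=set0) (C_convex : convex_set C).

Lemma y_step_subgradient bd z x lam mu nu y :
  y_step A L rho1 rho2 rho3 f bd z x lam mu nu y ->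
  strong_subgradient s f y (mu + rho2 *: (L z - y)).
Proof.
apply: (@argmin_strong_subgradient _ f s rho2 f_proper f_sconvex _ 0%E
  ('[lam, A z - bd] + '[nu, z - x] + rho1 / 2 * `|A z - bd| ^+ 2
   + rho3 / 2 * `|z - x| ^+ 2)) => // v.
by rewrite /augmented_lagrangian add0e adde0; congr (_ + _%:E)%E; ring.
Qed.

Lemma x_step_subgradient bd z y lam mu nu x : effdom f y ->
  x_step A L rho1 rho2 rho3 f C bd z y lam mu nu x ->
  strong_subgradient 0 (indicator C) x (nu + rho3 *: (z - x)).
Proof.
move=> fy; apply: (@argmin_strong_subgradient _ _ 0 rho3
  (indicator_proper C_neq0) (indicator_strongly_convex C_convex) _ (f y)
  ('[lam, A z - bd] + '[mu, L z - y] + rho1 / 2 * `|A z - bd| ^+ 2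
   + rho2 / 2 * `|L z - y| ^+ 2)) => [|v].
  exact: effdom_fin_num.
by rewrite /augmented_lagrangian; congr (_ + _%:E)%E; ring.
Qed.

(** The source condition provides Lagrange multipliers of the solution. If
    [adjoint] returns its default value [0], the multiplier [0] serves. *)
Lemma source_multiplier mu nu :
  dom_adjoint (dom L) L mu ->
  range (adjoint setT A) (adjoint (dom L) L mu + nu) ->
  exists lam : H, forall h, dom L h -> '[lam, A h] + '[mu, L h] + '[nu, h] = 0.
Proof.
move=> [w0 w0_adj] [v _ vE].
have L_adj : is_adjoint (dom L) L mu (adjoint (dom L) L mu).
  by rewrite /adjoint; case: xgetP => [w _ //|/(_ w0)].
suff [lam lam_adj] : exists lam, is_adjoint setT A lam (adjoint (dom L) L mu + nu).
  exists (- lam) => h h_dom.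
  have := L_adj h h_dom; have := lam_adj h I; rewrite !innerE.
  by rewrite (innerC lam) (innerC mu) (innerC nu); lra.
rewrite -vE /adjoint; case: xgetP => [w _ w_adj|_]; first by exists v.
by exists 0 => u _; rewrite !inner0r.
Qed.

Variables (bd b : H) (xdag : X) (lamdag : H) (mudag : Y) (nudag : X).
Variables (z : nat -> X) (y : nat -> Y) (x : nat -> X).
Variables (lam : nat -> H) (mu : nat -> Y) (nu : nat -> X).

Let wdag := State xdag (L xdag) xdag lamdag mudag nudag.
Let w n := State (z n) (y n) (x n) (lam n) (mu n) (nu n).

Lemma fixed_linear_step : dom L xdag -> A xdag = b ->
  (forall h, dom L h -> '[lamdag, A h] + '[mudag, L h] + '[nudag, h] = 0) ->
  linear_step A L Q rho1 rho2 rho3 b wdag wdag.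
Proof.
move=> xdag_dom Axdag kkt; split=> //=.
  by rewrite Axdag !subrr !scaler0 !addr0.
move=> h /kkt <-; rewrite !subrr !scaler0 !addr0.
by rewrite raddf0 inner0l addr0.
Qed.

(** The updated multipliers are the subgradients produced by the [y]- and
    [x]-minimizations, so all monotonicity inequalities come from pairs of
    subgradients of the same function; for the error the modulus [s] comes from
    the iterate alone. *)
Lemma admm_orbit delta z0 y0 x0 lam0 mu0 nu0 :
  0 <= s -> `|bd - b| <= delta ->
  linear_step A L Q rho1 rho2 rho3 b wdag wdag ->
  strong_subgradient 0 f (L xdag) mudag ->
  strong_subgradient 0 (indicator C) xdag nudag ->
  is_proximal_admm A L Q rho1 rho2 rho3 f C bd z0 y0 x0 lam0 mu0 nu0
    z y x lam mu nu ->
  noisy_orbit A L Q rho1 rho2 rho3 s delta b bd wdag w.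
Proof.
move=> s_ge0 noise fixed f_dag C_dag [_ _ steps].
have y_sub n : strong_subgradient s f (y n.+1) (mu n.+1).
  by have [_ /y_step_subgradient + _ [_ -> _]] := steps n.
have x_sub n : strong_subgradient 0 (indicator C) (x n.+1) (nu n.+1).
  by have [_ _ /(x_step_subgradient (y_sub n).1) + [_ _ ->]] := steps n.
split=> // [n|n|n|n|n] /=.
- have [/z_step_euler[z_dom euler] _ _ [lamE muE nuE]] := steps n.
  split=> //= h /euler <-; rewrite lamE muE nuE.
  by rewrite -!addrA -!scalerDr !addrA !subrK.
- by have := strong_subgradient_monotone (y_sub n) f_dag; rewrite addr0.
- have := strong_subgradient_monotone (x_sub n) C_dag.
  by rewrite addr0 mul0r.
- apply: le_trans (strong_subgradient_monotone (y_sub n.+1) (y_sub n)).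
  by rewrite mulr_ge0 ?addr_ge0 ?sqr_ge0.
- have := strong_subgradient_monotone (x_sub n.+1) (x_sub n).
  by rewrite addr0 mul0r.
Qed.

End admm_orbits.

(** * The convergence rate *)

Lemma bigO_of_sqr_le {R : realType} {V : normedModType R} (v : R -> V) (q : R -> R) K :
  0 <= K -> (\forall t \near (0 : R)^'+, `|v t| ^+ 2 <= K * q t ^+ 2) ->
  v =O_ ((0 : R)^'+) q.
Proof.
move=> K_ge0 v_le; apply/eqO_exP; exists (Num.sqrt K + 1).
  by rewrite ltr_wpDl ?sqrtr_ge0.
near=> t; apply: (@le_trans _ _ (Num.sqrt K * `|q t|)); last first.
  by rewrite ler_wpM2r// lerDl.
rewrite -(@ler_pXn2r _ 2) ?nnegrE ?mulr_ge0 ?sqrtr_ge0//.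
rewrite exprMn sqr_sqrtr// real_normK ?num_real//.
by near: t.
Unshelve. all: by end_near. Qed.

Theorem theorem3p2 (R : realType) (X Y H : hilbertType R)
    (A : {linear X -> H}) (Q : {linear X -> X}) (C : set X)
    (L : partial_linear X Y) (c0 : R) (f : Y -> \bar R) (s : R)
    (A_bounded : bounded_operator A)
    (Q_bounded : bounded_operator Q)
    (Q_selfadjoint : self_adjoint Q)
    (Q_psd : positive_semidefinite Q)
    (C_closed : closed C)
    (C_convex : convex_set C)
    (L_dense : densely_defined L)
    (L_closed : closed_operator L)
    (c0_gt0 : 0 < c0)
    (AL_coercive : forall x, dom L x ->
      c0 * `|x| ^+ 2 <= `|A x| ^+ 2 + `|L x| ^+ 2)
    (f_proper : proper_function f)
    (f_lsc : lower_semicontinuous f)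
    (s_gt0 : 0 < s)
    (f_sconvex : strongly_convex s f)
    (rho1 rho2 rho3 : R)
    (rho1_gt0 : 0 < rho1) (rho2_gt0 : 0 < rho2) (rho3_gt0 : 0 < rho3)
    (z0 : X) (y0 : Y) (x0 : X) (lam0 : H) (mu0 : Y) (nu0 : X)
    (b : H)
    (b_consistent : exists xhat : X,
      [/\ dom L xhat, C xhat, effdom f (L xhat) & A xhat = b])
    (xdag : X)
    (xdag_sol : argmin [set x | [/\ A x = b, C x & dom L x]]
      (fun x => f (L x)) xdag)
    (source_condition : exists (mudag : Y) (nudag : X),
      [/\ subdifferential f (L xdag) mudag,
          dom_adjoint (dom L) L mudag,
          subdifferential (indicator C) xdag nudag &
          range (adjoint setT A) (adjoint (dom L) L mudag + nudag)])
    (bd : R -> H)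
    (bd_noise : forall delta, 0 < delta -> `|bd delta - b| <= delta)
    (z : R -> nat -> X) (y : R -> nat -> Y) (x : R -> nat -> X)
    (lam : R -> nat -> H) (mu : R -> nat -> Y) (nu : R -> nat -> X)
    (admm : forall delta, 0 < delta ->
      is_proximal_admm A L Q rho1 rho2 rho3 f C (bd delta)
        z0 y0 x0 lam0 mu0 nu0
        (z delta) (y delta) (x delta) (lam delta) (mu delta) (nu delta))
    (k : R -> nat) (k_sim : sim_inverse k) :
  let rate := fun delta : R => delta `^ (1 / 4) in
  [/\ (fun delta => x delta (k delta) - xdag) =O_ ((0 : R)^'+) rate,
      (fun delta => y delta (k delta) - L xdag) =O_ ((0 : R)^'+) rate &
      (fun delta => z delta (k delta) - xdag) =O_ ((0 : R)^'+) rate].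
Proof.
have [a1 [a2 [a1_gt0 a1_le_a2 k_bounds]]] := k_sim.
have [mudag [nudag [f_sub L_adj C_sub source]]] := source_condition.
have [[Axdag Cxdag xdag_dom] xdag_min] := xdag_sol.
have f_xdag : effdom f (L xdag).
  have [xhat [xhat_dom Cxhat f_xhat Axhat]] := b_consistent.
  exact: le_lt_trans (xdag_min xhat (And3 Axhat Cxhat xhat_dom)) f_xhat.
have [lamdag kkt] := source_multiplier L_adj source.
have C_neq0 : C !=set0 by exists xdag.
have f_dag := subdifferential_strong_subgradient f_proper f_xdag f_sub.
have C_dag : strong_subgradient 0 (indicator C) xdag nudag.
  apply: subdifferential_strong_subgradient C_sub; first exact: indicator_proper.
  by rewrite effdom_indicator.
pose wdag := State xdag (L xdag) xdag lamdag mudag nudag.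
have fixed : linear_step A L Q rho1 rho2 rho3 b wdag wdag.
  exact: fixed_linear_step.
pose w delta n := State (z delta n) (y delta n) (x delta n)
  (lam delta n) (mu delta n) (nu delta n).
have w_orbit delta : 0 < delta ->
    noisy_orbit A L Q rho1 rho2 rho3 s delta b (bd delta) wdag (w delta).
  move=> delta_gt0; exact: (admm_orbit Q_selfadjoint f_proper f_sconvex C_neq0 C_convex
    (ltW s_gt0) (bd_noise _ delta_gt0) fixed f_dag C_dag (admm _ delta_gt0)).
pose w0 := State z0 y0 x0 lam0 mu0 nu0.
have w0E delta : 0 < delta -> w delta 0%N = w0.
  by move=> /admm[[z0E y0E x0E] [l0E m0E n0E] _]; rewrite /w z0E y0E x0E l0E m0E n0E.
have [K K_ge0 rate_le] := @orbit_uniform_rate _ _ _ _ A L Q rho1 rho2 rho3 c0 s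
  (energy Q rho1 rho2 rho3 (sub_state w0 wdag)) a1 a2
  rho1_gt0 rho2_gt0 rho3_gt0 Q_selfadjoint Q_psd c0_gt0 AL_coercive s_gt0 a1_gt0
  (le_trans (ltW a1_gt0) a1_le_a2).
move=> rate.
have main : \forall delta \near (0 : R)^'+,
    [/\ `|x delta (k delta) - xdag| ^+ 2 <= K * rate delta ^+ 2,
        `|y delta (k delta) - L xdag| ^+ 2 <= K * rate delta ^+ 2 &
        `|z delta (k delta) - xdag| ^+ 2 <= K * rate delta ^+ 2].
  near=> delta.
  have delta_gt0 : 0 < delta by near: delta; exact: nbhs_right_gt.
  have delta_le1 : delta <= 1 by near: delta; exact: nbhs_right_le.
  (* This makes [k delta] at least 2: both ends of the last increment then satisfy
     the subgradient inclusions. *)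
  have delta_lt : delta < a1 by near: delta; exact: nbhs_right_lt.
  have /andP[k_ge k_le] : a1 * delta^-1 <= (k delta)%:R <= a2 * delta^-1.
    by near: delta.
  have rate4 : rate delta ^+ 4 = delta.
    rewrite /rate -powR_mulrn ?powR_ge0// -powRrM.
    by rewrite mul1r mulVf ?pnatr_eq0// powRr1 ?ltW.
  apply: (rate_le _ b (bd delta) wdag (w delta)).
  - rewrite powR_gt0//= -(@ler_pXn2r _ 4) ?nnegrE ?powR_ge0//.
    by rewrite expr1n rate4.
  - by rewrite rate4; exact: w_orbit.
  - by rewrite w0E.
  - rewrite -(ltr_nat R); apply: lt_le_trans k_ge.
    by rewrite ltr_pdivlMr// mul1r.
  - rewrite rate4 mulrC -ler_pdivrMr// k_ge /=.
    by rewrite -ler_pdivlMr.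
by split; apply: (bigO_of_sqr_le K_ge0); near=> delta;
  have [] : _ := near main delta _.
Unshelve. all: by end_near. Qed.
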